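(* Let $p$ and $q$ be distinct prime natural numbers such that $p\equiv 3 \pmod{20}$, $q\equiv 4\pmod 5$, the residue class $\overline{p}$ of $p$ modulo $q^4$ is a generator of the multiplicative group $(U(\mathbb{Z}_{q^4}),\cdot)$, and $2$ is a $5$-power residue modulo $q$. Then the equation $$x^4-q^4=p\,y^5$$ has no nontrivial solution $(x,y)\in\mathbb{Z}^2$ such that $p\nmid y$ and $\gcd(x,y)=1$.
   Context: $\mathbb{Z}_{q^4}=\mathbb{Z}/q^4\mathbb{Z}$, and $U(\mathbb{Z}_{q^4})$ is its group of units. ''$2$ is a $5$-power residue modulo $q$'' means that there is an integer $a$ with $a^5\equiv 2\pmod q$. A solution $(x,y)$ is trivial if $y=0$, i.e. $(x,y)=(\pm q,0)$, and nontrivial otherwise; since the condition $p\nmid y$ already forces $y\neq 0$, the assertion is that there are no integers $x,y$ with $p\nmid y$, $\gcd(x,y)=1$ and $x^4-q^4=py^5$. *)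

(* Defs.v *)
From mathcomp Require Import all_boot all_order all_algebra all_fingroup all_solvable.

Set Implicit Arguments.
Unset Strict Implicit.
Unset Printing Implicit Defensive.

Import GRing.Theory.

Local Open Scope ring_scope.

Definition power_residue (k : nat) (c m : int) : Prop :=
  exists a : int, (a ^+ k = c %[mod m])%Z.

(* ['Z_m] is the ring Z/mZ only for 1 < m. *)
Definition class_generates_units (m p : nat) : Prop :=
  exists2 u : {unit 'Z_m}, val u = p%:R & generator (units_Zp m) u.

Definition trivial_solution (xy : int * int) : Prop := xy.2 = 0.

(* Main.v *)
Require Import Defs.
From HB Require Import structures.
From mathcomp Require Import all_boot all_order all_algebra all_fingroup all_solvable.
From mathcomp Require Import closed_field.
From mathcomp Require Import ring zify.

(** Write [Q] for the prime [q].  The factors of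
    [(x^2 + Q^2) (x^2 - Q^2) = p y^5] have no common divisor except a power
    of 2, and [p] does not divide the first one, because [-1] is not a square
    modulo [p = 3 mod 4] and [x], [Q] are coprime.  So [x^2 + Q^2] if [x] is
    even, and half of it if [x] is odd, is a fifth power, and unique
    factorization in the Gaussian integers ([gauss_fifth_power]) applies.

    If [x] is even, then [x + iQ = (c + id)^5], so that
    [Q = d (5c^4 - 10c^2d^2 + d^4)] and [d] is one of [1, -1, Q, -Q].  The
    residue of [Q] modulo 5 excludes [1] and [-Q]; the value [-1] gives
    [Q <= 4]; and [d = Q] leads to [(Q^2 - 5c^2)^2 = 20c^4 + 1], hence to
    [r^4 = 5s^4 + 1] with [c = rs], which an infinite descent
    ([pow4_eq_5pow4_add1]) reduces to the trivial solution [s = 0].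

    If [x] is odd, write [x + iQ = (1 + i) (A + iB)], that is [x = A - B] and
    [Q = A + B].  Now [A + iB = (c + id)^5], and with [e = c + d] and [f = cd]
    the sum of the two parts factors as [Q = e (e^4 - 20f^2)].  Congruences
    modulo 5 and [pow4_eq_20square_add1] leave only [e = -1], that is
    [Q + 1 = 20f^2].  Moreover [p] divides [AB], and [p = 3 mod 20] forces [p]
    to divide [f] itself: modulo [p], the quotient of [c + id] by its conjugate
    has an order dividing both 10 and [p + 1], hence dividing 2
    ([prime_dvd_fifth_power_parts]).  Thus [p] divides [Q + 1], while
    [Q = 3 mod 4], and by reciprocity [p] is a square modulo [Q]
    ([half_power_eq1_dvd_succ]).  A generator of the units modulo [Q^4] is not,
    because its powers include the nonsquare [-1]
    ([generator_half_power_neq1]); this is the contradiction. *)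

Set Implicit Arguments.
Unset Strict Implicit.
Unset Printing Implicit Defensive.

Import GRing.Theory Num.Theory Order.TTheory.

(** * Coprime factors of powers *)

Local Open Scope nat_scope.

Lemma expn_gcdn (n a b : nat) : gcdn (a ^ n) (b ^ n) = (gcdn a b ^ n)%N.
Proof.
have [g0|g0] := posnP (gcdn a b).
  have /andP[/eqP-> /eqP->] : (a == 0%N) && (b == 0%N).
    by move: (gcdn_gt0 a b); rewrite g0; lia.
  by rewrite !gcdnn.
have /dvdnP[a' Ha] := dvdn_gcdl a b; have /dvdnP[b' Hb] := dvdn_gcdr a b.
have co : coprime a' b'.
  by rewrite /coprime -(eqn_pmul2r g0) muln_gcdl mul1n -Ha -Hb.
move: (gcdn a b) Ha Hb => g -> ->.
by rewrite !expnMn -muln_gcdl (eqP (coprimeXl _ (coprimeXr _ co))) mul1n.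
Qed.

(** The [n]-th root of a factor is its gcd with the root of the product:
    [gcd (u, w) ^ n = gcd (u ^ n, u v) = u gcd (u ^ n.-1, v) = u]. *)
Lemma coprime_mul_expn (n u v w : nat) : (0 < n)%N -> coprime u v ->
  (u * v = w ^ n)%N -> exists2 s, u = (s ^ n)%N & exists2 t, v = (t ^ n)%N & w = (s * t)%N.
Proof.
move=> n0 co E.
have fac u' v' : coprime u' v' -> (u' * v' = w ^ n)%N -> u' = (gcdn u' w ^ n)%N.
  move=> co' E'; rewrite -expn_gcdn -E' -(prednK n0) expnS -muln_gcdr.
  by rewrite (eqP (coprimeXl _ co')) muln1.
have Eu := fac _ _ co E.
have Ev : v = (gcdn v w ^ n)%N by apply: (fac v u); rewrite 1?coprime_sym // mulnC.
exists (gcdn u w) => //; exists (gcdn v w) => //.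
by apply/eqP; rewrite -(eqn_exp2r _ _ n0) expnMn -Eu -Ev E.
Qed.

(** A prime [l] in front of the power goes entirely with one of the two
    factors, since it divides one of them. *)
Lemma coprime_mul_prime_expn (l n u v w : nat) : prime l -> (0 < n)%N ->
  coprime u v -> (u * v = l * w ^ n)%N ->
  exists s t, w = (s * t)%N /\
   ((u = l * s ^ n /\ v = t ^ n)%N \/ (u = s ^ n /\ v = l * t ^ n)%N).
Proof.
move=> pl n0 co E.
have fac u' v' : coprime u' v' -> (u' * v' = l * w ^ n)%N -> l %| u' ->
    exists s t, [/\ w = s * t, u' = l * s ^ n & v' = t ^ n]%N.
  move=> co' E' /dvdnP[k Ek].
  have [||s Es [t Et Ew]] := @coprime_mul_expn n k v' w n0.
  - by apply: coprime_dvdl co'; rewrite Ek dvdn_mulr.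
  - by apply/eqP; rewrite -(eqn_pmul2l (prime_gt0 pl)) -E' Ek mulnA (mulnC l).
  by exists s, t; split=> //; rewrite Ek Es mulnC.
have /orP[lu|lv] : (l %| u) || (l %| v) by rewrite -Euclid_dvdM // E dvdn_mulr.
  by have [s [t [Ew Eu Ev]]] := fac _ _ co E lu; exists s, t; split=> //; left.
have [||s [t [Ew Ev Eu]]] := fac v u _ _ lv; rewrite 1?coprime_sym 1?(mulnC v) //.
by exists t, s; split; [rewrite mulnC | right].
Qed.

(** * Three quartic equations *)

Lemma fourth_power_mod3 n : n ^ 4 = (n %% 3 != 0) %[mod 3].
Proof.
rewrite -modnXm; have : n %% 3 < 3 by rewrite ltn_mod.
by case: (n %% 3) => [|[|[|]]].
Qed.

Lemma fourth_power_mod5 n : n ^ 4 = (n %% 5 != 0) %[mod 5].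
Proof.
rewrite -modnXm; have : n %% 5 < 5 by rewrite ltn_mod.
by case: (n %% 5) => [|[|[|[|[|]]]]].
Qed.

Lemma fourth_power_mod16 n : n ^ 4 = odd n %[mod 16].
Proof.
rewrite -modnXm -(@odd_mod n 16) //; have : n %% 16 < 16 by rewrite ltn_mod.
by move: (n %% 16); do 16! [case=> //].
Qed.

Lemma square_mod3 n : n ^ 2 = (n %% 3 != 0) %[mod 3].
Proof.
rewrite -modnXm; have : n %% 3 < 3 by rewrite ltn_mod.
by case: (n %% 3) => [|[|[|]]].
Qed.

Lemma square_mod8 n : odd n -> n ^ 2 = 1 %[mod 8].
Proof.
rewrite -modnXm -(@odd_mod n 8) //; have : n %% 8 < 8 by rewrite ltn_mod.
by move: (n %% 8); do 8! [case=> //].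
Qed.

(** Infinite descent on [s].  Factoring [r^4 - 1 = (r^2 - 1) (r^2 + 1)] gives,
    up to explicit powers of 2, coprime factors of [5 s'^4] with [s = 2 s'],
    so each is a fourth power or five times one.  When 5 goes with [r^2 - 1],
    the fourth power [m^4 = 20 n^4 + 1] splits again in the same way, and its
    factors satisfy the original equation [M^4 = 5 (2 N)^4 + 1] with [2 N]
    smaller than [s].  The other placements of 5 are impossible modulo 5 or
    modulo 3; the latter is where [3] not dividing [r] matters, as
    [(r, s) = (3, 2)] is a solution.  The hypothesis passes to [M] because
    [m^2 = 2 M^4 - 1] would be 2 modulo 3 if 3 divided [M]. *)
Lemma pow4_eq_5pow4_add1 r s : r ^ 4 = 5 * s ^ 4 + 1 -> ~~ (3 %| r) -> s = 0.
Proof.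
elim/ltn_ind: s r => s IH r E r3.
have ro : odd r.
  by move: (fourth_power_mod16 r) (fourth_power_mod16 s) E; move: (r ^ 4) (s ^ 4); case: (odd r) (odd s) => [] []; lia.
have r8 := square_mod8 ro.
have [K EK] : exists K, r ^ 2 = 8 * K + 1 by exists (r ^ 2 %/ 8); lia.
have E1 : 16 * (K * (4 * K + 1)) = 5 * s ^ 4.
  have : (r ^ 2) ^ 2 = 5 * s ^ 4 + 1 by rewrite -expnM.
  by rewrite EK; lia.
have so : ~~ odd s by move: (fourth_power_mod16 s); case: (odd s); lia.
have [s' Es] : exists s', s = 2 * s' by exists s./2; lia.
have E2 : K * (4 * K + 1) = 5 * s' ^ 4 by move: E1; rewrite Es expnMn; lia.
have co1 (k : nat) : coprime k (4 * k + 1) by rewrite /coprime gcdnMDl gcdn1.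
have [//|//||n [m [Es' [[Kn em]|[Kn em]]]]] := coprime_mul_prime_expn _ _ _ E2.
- exact: co1.
- have mo : odd m by move: (congr1 odd em); rewrite oddX oddD !oddM /=.
  have m8 := square_mod8 mo.
  have [K' EK'] : exists K', m ^ 2 = 8 * K' + 1 by exists (m ^ 2 %/ 8); lia.
  have E3 : 4 * (K' * (4 * K' + 1)) = 5 * n ^ 4.
    have : (m ^ 2) ^ 2 = 20 * n ^ 4 + 1 by rewrite -expnM -em; lia.
    by rewrite EK'; lia.
  have no : ~~ odd n by move: (fourth_power_mod16 n); case: (odd n); lia.
  have [n' En] : exists n', n = 2 * n' by exists n./2; lia.
  have E4 : K' * (4 * K' + 1) = 20 * n' ^ 4 by move: E3; rewrite En expnMn; lia.
  have [L EL] : exists L, K' = 4 * L.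
    have /dvdnP[L ->] : 4 %| K'; last by exists L; rewrite mulnC.
    rewrite -(@Gauss_dvdl _ _ (4 * K' + 1)) ?E4; first by rewrite -(mulnA 4 5) dvdn_mulr.
    by rewrite /coprime mulnC gcdnMDl gcdn1.
  have E5 : L * (4 * K' + 1) = 5 * n' ^ 4 by move: E4; rewrite EL; lia.
  have [//|//||N [M [En' [[LN eM]|[LN eM]]]]] := coprime_mul_prime_expn _ _ _ E5.
  + by apply: coprime_dvdl (co1 K'); rewrite EL dvdn_mull.
  + have M3 : ~~ (3 %| M).
      apply/negP=> M3; move: (fourth_power_mod3 M) (fourth_power_mod3 N) (square_mod3 m).
      rewrite (eqP M3) EK' -eM EL LN /=; move: (N ^ 4) (_ != 0) (_ != 0).
      by clear; move=> a b c; case: b; case: c; lia.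
    have N0 : 2 * N = 0.
      case: (posnP N) => [->//|Npos]; apply: (IH _ _ M) => //; last by rewrite -eM EL LN expnMn; lia.
      rewrite Es Es' En En'.
      have Mpos : 0 < M by case: (M) M3.
      have mpos : 0 < m by case: (m) em => //; lia.
      have : 0 < M * m by rewrite muln_gt0 Mpos.
      by clear -Npos; nia.
    have -> : s = 2 * N * (2 * M * m) by rewrite Es Es' En En'; clear; nia.
    by rewrite N0.
  + move: (fourth_power_mod5 N) eM; rewrite EL LN; move: (M ^ 4) (N ^ 4) (_ != 0).
    by clear; move=> a b []; lia.
- have n3 : n %% 3 == 0.
    apply: contraR r3 => n3; move: (fourth_power_mod3 n) (square_mod3 r); rewrite n3.
    by rewrite EK Kn /dvdn; move: (n ^ 4); case: eqP => //= _ a; lia.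
  move: (fourth_power_mod3 n) (fourth_power_mod3 m); rewrite n3 -Kn /=.
  by move: em; move: (m ^ 4); case: (_ != 0) => /=; lia.
Qed.

(** Completing the square turns the equation into [X^2 = 20 c^4 + 1] with
    [X = q^2 - 5 c^2], and then [X = 10 k + 1] and [k (5 k + 1) = c^4].  The
    coprime factors [k] and [5 k + 1] are fourth powers up to sign, which
    leads to [r^4 = 5 s^4 + 1] with [c = r s], the minus sign being excluded
    modulo 5.  If 3 divided [r], then [q^2 = 5 c^2 + 10 s^4 + 1] would be 2
    modulo 3, so [pow4_eq_5pow4_add1] applies. *)
Lemma quartic_form_eq1 (q c : nat) : q ^ 4 + 5 * c ^ 4 = 10 * c ^ 2 * q ^ 2 + 1 ->
  q ^ 2 = 1 %[mod 5] -> q ^ 2 = 1.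
Proof.
move=> E q5.
pose X : int := (q%:Z ^+ 2 - 5 * c%:Z ^+ 2)%R.
have EX : (X ^+ 2 = 20 * c%:Z ^+ 4 + 1)%R by rewrite /X; lia.
have [k Ek] : exists k : int, (X = 10 * k + 1)%R.
  have [Y EY] : exists Y : int, (X = 5 * Y + 1)%R.
    exists ((q ^ 2 %/ 5)%:Z - c%:Z ^+ 2)%R; rewrite /X; move: q5 (divn_eq (q ^ 2) 5).
    by move: (c%:Z ^+ 2)%R; clear; lia.
  have E1 : (5 * (Y * Y) + 2 * Y = 4 * c%:Z ^+ 4)%R.
    by move: EX; rewrite EY; clear; nia.
  have [y Ey] : exists y : int, Y = (2 * y)%R \/ Y = (2 * y + 1)%R.
    by exists (Y %/ 2)%Z; clear; lia.
  case: Ey E1 => Ey E1; first by exists y; rewrite EY Ey; clear; lia.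
  by exfalso; move: E1; rewrite Ey; clear; nia.
have Ekc : (k * (5 * k + 1) = c%:Z ^+ 4)%R.
  by move: EX; rewrite Ek; clear; nia.
have [[l El Elc]|[l El Elc]] : (exists2 l : nat, k = Posz l & l * (5 * l + 1) = c ^ 4) \/
    (exists2 l : nat, k = (- Posz l)%R & l * (5 * l - 1) = c ^ 4).
- move: Ekc; case: k Ek => l _ Ekc.
    by left; exists l => //; apply/eqP; rewrite -eqz_nat; apply/eqP; move: Ekc; clear; lia.
  right; exists l.+1; first by rewrite NegzE.
  by apply/eqP; rewrite -eqz_nat; apply/eqP; move: Ekc; rewrite NegzE; clear; lia.
- have co : coprime l (5 * l + 1) by rewrite /coprime gcdnMDl gcdn1.
  have [a El' [b Eb Ec]] := coprime_mul_expn (isT : 0 < 4) co Elc.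
  have E' : b ^ 4 = 5 * a ^ 4 + 1 by rewrite -Eb El'.
  have q2 : q ^ 2 = 5 * c ^ 2 + 10 * a ^ 4 + 1.
    by move: Ek; rewrite El El' /X; clear; lia.
  rewrite q2 Ec (@pow4_eq_5pow4_add1 b a) //.
  apply/negP=> /dvdnP[b' Eb']; move: (square_mod3 q) E'.
  rewrite q2 Ec Eb' !expnMn; rewrite mulnA; move: (_ != 0) (a ^ 2 * b' ^ 2) (b' ^ 4) (a ^ 4).
  by clear; case; lia.
- have [l0|l0] := posnP l.
    have c0 : c = 0 by move/esym/eqP: Elc; rewrite l0 expn_eq0 => /andP[/eqP].
    by move: Ek; rewrite El l0 /X c0; clear; lia.
  have co : coprime l (5 * l - 1).
    have -> : 5 * l - 1 = 4 * l + l.-1 by lia.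
    by rewrite /coprime gcdnMDl -/(coprime _ _) coprimenP.
  have [a El' [b Eb Ec]] := coprime_mul_expn (isT : 0 < 4) co Elc.
  have E' : b ^ 4 + 1 = 5 * a ^ 4 by rewrite -Eb -El'; clear -l0; lia.
  by move: (fourth_power_mod5 b) E'; move: (b ^ 4) (a ^ 4) (_ != 0); clear; move=> u v []; lia.
Qed.

(** Splitting [q^4 - 1] and then [q^2 - 1] into coprime factors leaves
    [5 w^2 = 2 v^2 + 1] or [10 w^2 = v^2 + 1] with [v w] even, and neither is
    solvable modulo 8.  The residue of [q] modulo 5 says which factor takes
    the 5; it also excludes the solution [q = 3], [f = 2]. *)
Lemma pow4_eq_20square_add1 (q f : nat) : q ^ 4 = 20 * f ^ 2 + 1 -> q = 4 %[mod 5] -> False.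
Proof.
move=> E q5.
have qo : odd q by move: (congr1 odd E); rewrite oddX oddD oddM.
have q8 := square_mod8 qo.
have [K EK] : exists K, q ^ 2 = 8 * K + 1 by exists (q ^ 2 %/ 8); lia.
have E1 : 4 * (K * (4 * K + 1)) = 5 * f ^ 2.
  have : (q ^ 2) ^ 2 = 20 * f ^ 2 + 1 by rewrite -expnM.
  by rewrite EK; clear; nia.
have fo : ~~ odd f.
  by move: (congr1 odd E1); rewrite !oddM; case: (odd f).
have [f' Ef] : exists f', f = 2 * f' by exists f./2; lia.
have E2 : K * (4 * K + 1) = 5 * f' ^ 2 by move: E1; rewrite Ef expnMn; clear; lia.
have K5 : 5 %| K.
  have : q ^ 2 = 1 %[mod 5] by rewrite -modnXm q5.
  by rewrite EK; clear; lia.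
have co1 (k : nat) : coprime k (4 * k + 1) by rewrite /coprime gcdnMDl gcdn1.
have [//|//||g [h [Ef' [[Kg eh]|[Kg eh]]]]] := coprime_mul_prime_expn _ _ _ E2.
- exact: co1.
- have ho : odd h by move: (congr1 odd eh); rewrite oddX oddD !oddM /=.
  have h8 := square_mod8 ho.
  have go : ~~ odd g.
    apply/negP=> /square_mod8; move: h8; rewrite -eh Kg.
    by move: (g ^ 2); clear; lia.
  have [t Et] : exists t, q = 10 * t + 9 by exists (q %/ 10); clear -qo q5; lia.
  have E3 : (5 * t + 4) * (t + 1) = 2 * g ^ 2.
    by move: EK; rewrite Kg Et; clear; nia.
  have co2 : coprime (5 * t + 4) (t + 1).
    have -> : 5 * t + 4 = 4 * (t + 1) + t by lia.
    rewrite coprime_sym /coprime gcdnMDl -/(coprime _ _) addn1.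
    exact: coprimeSn.
  have [//|//||v [w [Eg' [[tv tw]|[tv tw]]]]] := coprime_mul_prime_expn _ _ _ E3.
  + exact: co2.
  + have {}E3 : 5 * w ^ 2 = 2 * v ^ 2 + 1 by move: tv tw; clear; lia.
    have wo : odd w by move: (congr1 odd E3); rewrite oddD !oddM; case: (odd w).
    have vo : ~~ odd v.
      apply/negP=> /square_mod8; move: (square_mod8 wo) E3.
      by move: (w ^ 2) (v ^ 2); clear; lia.
    have [u Ev] : exists u, v = 2 * u by exists v./2; lia.
    move: (square_mod8 wo) E3; rewrite Ev expnMn.
    by move: (w ^ 2) (u ^ 2); clear; lia.
  + have {}E3 : 10 * w ^ 2 = v ^ 2 + 1 by move: tv tw; clear; lia.
    have vo : odd v by move: (congr1 odd E3); rewrite oddD !oddM; case: (odd v).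
    have wo : ~~ odd w by move: go; rewrite Eg' oddM vo.
    have [u Ew] : exists u, w = 2 * u by exists w./2; lia.
    move: (square_mod8 vo) E3; rewrite Ew expnMn.
    by move: (v ^ 2) (u ^ 2); clear; lia.
- by move: K5 eh; clear; lia.
Qed.

(** * Gaussian integers *)

Local Open Scope ring_scope.

(** An alias of [int * int], so that it does not carry the componentwise
    product. *)
Definition gauss := (int * int)%type.

HB.instance Definition _ := GRing.Zmodule.on gauss.

Definition gaussI (a b : int) : gauss := (a, b).
Definition gauss_one : gauss := (1, 0).
Definition gauss_mul (z w : gauss) : gauss :=
  (z.1 * w.1 - z.2 * w.2, z.1 * w.2 + z.2 * w.1).

Lemma gauss_eq (z w : gauss) : z.1 = w.1 -> z.2 = w.2 -> z = w.
Proof. by case: z w => ? ? [? ?] /= -> ->. Qed.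

Fact gauss_mulA : associative gauss_mul.
Proof. by move=> x y z; apply: gauss_eq; rewrite /=; ring. Qed.
Fact gauss_mulC : commutative gauss_mul.
Proof. by move=> x y; apply: gauss_eq; rewrite /=; ring. Qed.
Fact gauss_mul1 : left_id gauss_one gauss_mul.
Proof. by move=> x; apply: gauss_eq; rewrite /=; ring. Qed.
Fact gauss_mulDl : left_distributive gauss_mul +%R.
Proof. by move=> x y z; apply: gauss_eq; rewrite /=; ring. Qed.
Fact gauss_oner_neq0 : gauss_one != 0.
Proof. by []. Qed.

HB.instance Definition _ := GRing.Zmodule_isComNzRing.Build gauss
  gauss_mulA gauss_mulC gauss_mul1 gauss_mulDl gauss_oner_neq0.

Definition gnorm (z : gauss) : int := z.1 ^+ 2 + z.2 ^+ 2.
Definition gconj (z : gauss) : gauss := gaussI z.1 (- z.2).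
Definition gdvd (z w : gauss) : Prop := exists v : gauss, w = z * v.

Lemma gmulE (z w : gauss) :
  z * w = (z.1 * w.1 - z.2 * w.2, z.1 * w.2 + z.2 * w.1) :> gauss.
Proof. by []. Qed.
Lemma gaddE (z w : gauss) : z + w = (z.1 + w.1, z.2 + w.2) :> gauss.
Proof. by []. Qed.
Lemma goppE (z : gauss) : - z = (- z.1, - z.2) :> gauss.
Proof. by []. Qed.

Lemma gnormM z w : gnorm (z * w) = gnorm z * gnorm w.
Proof. by rewrite gmulE /gnorm /=; ring. Qed.

Lemma gnorm_ge0 z : 0 <= gnorm z.
Proof. by rewrite addr_ge0 ?sqr_ge0. Qed.

Lemma gnorm_eq0 z : gnorm z = 0 -> z = 0.
Proof.
move=> /eqP; rewrite paddr_eq0 ?sqr_ge0 // !sqrf_eq0 => /andP[/eqP z1 /eqP z2].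
exact: gauss_eq.
Qed.

Lemma gconjM z : z * gconj z = gaussI (gnorm z) 0.
Proof. by apply: gauss_eq; rewrite /gnorm /=; ring. Qed.

Lemma gmulf_eq0 (z w : gauss) : z * w = 0 -> z = 0 \/ w = 0.
Proof.
move=> E; have /eqP := gnormM z w; rewrite E {1}/gnorm /= eq_sym.
rewrite expr0n addr0 mulf_eq0 => /orP[] /eqP /gnorm_eq0; [left|right] => //.
Qed.

Lemma gmulI (u z w : gauss) : u <> 0 -> u * z = u * w -> z = w.
Proof.
move=> u0 E; apply/eqP; rewrite -subr_eq0; apply/eqP.
have /gmulf_eq0[] // : u * (z - w) = 0 by rewrite mulrBr E subrr.
Qed.

Lemma nearest_multiple (n m : int) : 0 < m ->
  exists k, 4 * (n - k * m) ^+ 2 <= m ^+ 2.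
Proof.
move=> m0; have := divz_eq n m; have := ltz_pmod n m0; have := modz_ge0 n (lt0r_neq0 m0).
move: (n %/ m)%Z (n %% m)%Z => d r r0 rm ->.
have [h|h] := lerP (2 * r) m; [exists d|exists (d + 1)].
  have -> : d * m + r - d * m = r by ring.
  by nia.
have -> : d * m + r - (d + 1) * m = r - m by ring.
by nia.
Qed.

(** Round both coordinates of [z / w]; the remainder then has norm at most
    half that of [w]. *)
Lemma gauss_division (z w : gauss) : w <> 0 ->
  exists k, gnorm (z - k * w) < gnorm w.
Proof.
move=> w0; have N0 : 0 < gnorm w.
  by rewrite lt_def gnorm_ge0 andbT; apply/eqP => /gnorm_eq0.
have [k1 H1] := nearest_multiple (z * gconj w).1 N0.
have [k2 H2] := nearest_multiple (z * gconj w).2 N0.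
exists (gaussI k1 k2).
have E : gnorm (z - gaussI k1 k2 * w) * gnorm w =
   ((z * gconj w).1 - k1 * gnorm w) ^+ 2 + ((z * gconj w).2 - k2 * gnorm w) ^+ 2.
  rewrite gaddE goppE !gmulE /gnorm /gconj /=; ring.
by move: (gnorm w) (gnorm _) E H1 H2 N0 => M L; move: (_ ^+ 2) (_ ^+ 2) => u v; nia.
Qed.

Lemma gauss_bezout (z w : gauss) :
  exists d s t : gauss, [/\ gdvd d z, gdvd d w & d = s * z + t * w].
Proof.
have [n] : exists n : nat, (`|gnorm w| <= n)%N by exists `|gnorm w|%N.
elim/ltn_ind: n z w => n IH z w.
have [-> _|/eqP w0 Hn] := eqVneq w 0.
  by exists z, 1, 0; split; [exists 1; rewrite mulr1|exists 0; rewrite mulr0|ring].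
have [k Hk] := gauss_division z w0.
have [||d [s [t [[a Ea] [b Eb] Ed]]]] := IH (absz (gnorm (z - k * w))) _ w (z - k * w) => //.
  by move: Hk (gnorm_ge0 (z - k * w)); lia.
exists d, t, (s - t * k); split; [|by exists a|by rewrite Ed; ring].
by exists (b + k * a); rewrite mulrDr -Eb mulrCA -Ea; ring.
Qed.

Definition gcoprime (z w : gauss) : Prop := exists s t : gauss, s * z + t * w = 1.

Lemma gcoprimeXr (n : nat) z w : gcoprime z w -> gcoprime z (w ^+ n).
Proof.
move=> [s [t E]]; elim: n => [|n [s' [t' E']]]; first by exists 0, 1; ring.
exists (s' * z * s + s' * t * w + t' * w ^+ n * s), (t' * t).
by rewrite exprS -[RHS]mulr1 -{1}E' -E; ring.
Qed.

Lemma gcoprime_dvd z w v : gcoprime z w -> gdvd z (w * v) -> gdvd z v.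
Proof.
move=> [s [t E]] [a Ea]; exists (s * v + t * a).
have -> : z * (s * v + t * a) = s * z * v + t * (z * a) by ring.
by rewrite -Ea mulrA -mulrDl E mul1r.
Qed.

Lemma gauss_unit4 (u : gauss) : gnorm u = 1 -> u ^+ 4 = 1.
Proof.
case: u => a b; rewrite /gnorm /= => E.
have : (a = 0 \/ a = 1 \/ a = -1) /\ (b = 0 \/ b = 1 \/ b = -1) by nia.
by case=> [[Ea|[Ea|Ea]] [Eb|[Eb|Eb]]]; move: E; rewrite Ea Eb.
Qed.

(** With [d] the gcd of [z] and [v], and [z = d a], the coprimality of [z]
    with [w] and of [a] with [v / d] makes [a] and [d ^+ n] divide each
    other. *)
Lemma gauss_coprime_factor_power n (z w v : gauss) : gcoprime z w -> z <> 0 ->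
  z * w = v ^+ n.+1 -> exists u d, gnorm u = 1 /\ z = u * d ^+ n.+1.
Proof.
move=> co z0 E; have [d [s [t [[a Ea] [b Eb] Ed]]]] := gauss_bezout z v.
have d0 : d <> 0 by move=> d0; apply: z0; rewrite Ea d0 mul0r.
have E1 : a * w = d ^+ n * b ^+ n.+1.
  by apply: (gmulI d0); rewrite !mulrA -Ea E Eb exprMn -exprS.
have co1 : gcoprime a (b ^+ n.+1).
  apply: gcoprimeXr; exists s, t; apply: (gmulI d0).
  by rewrite mulr1 {2}Ed Ea Eb; ring.
have [x Ex] : gdvd a (d ^+ n).
  by apply: (gcoprime_dvd co1); exists w; rewrite mulrC -E1.
have co2 : gcoprime (d ^+ n) w.
  have [s' [t' E']] : gcoprime w (d ^+ n).
    apply: gcoprimeXr; have [s' [t' E']] := co; exists t', (s' * a).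
    by rewrite -E' Ea; ring.
  by exists t', s'; rewrite addrC.
have [y Ey] : gdvd (d ^+ n) a.
  by apply: (gcoprime_dvd co2); exists (b ^+ n.+1); rewrite mulrC E1.
have a0 : a <> 0 by move=> a0; apply: z0; rewrite Ea a0 mulr0.
have Exy : gnorm y * gnorm x = 1.
  rewrite -gnormM; have -> : y * x = 1; last by rewrite /gnorm.
  by apply: (gmulI a0); rewrite mulr1 {2}Ey Ex; ring.
exists y, d; split; last by rewrite Ea Ey exprS; ring.
move: (gnorm y) (gnorm x) (gnorm_ge0 y) (gnorm_ge0 x) Exy => M N M0 N0 E2.
have [HM HN] : 0 < M /\ 0 < N by clear -M0 N0 E2; nia.
by clear -HM HN E2; nia.
Qed.

(** The Gaussian integers [A + iB] and [A - iB] are coprime, for any common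
    divisor divides [2A] and [2B], hence 2, and it also divides the odd norm.
    The unit in front of the fifth power is absorbed because it is its own
    fifth power. *)
Lemma gauss_fifth_power (A B a : int) : coprimez A B ->
  ~~ (2 %| A ^+ 2 + B ^+ 2)%Z -> A ^+ 2 + B ^+ 2 = a ^+ 5 ->
  exists c d, A = c ^+ 5 - 10 * c ^+ 3 * d ^+ 2 + 5 * c * d ^+ 4 /\
              B = 5 * c ^+ 4 * d - 10 * c ^+ 2 * d ^+ 3 + d ^+ 5.
Proof.
move=> /coprimezP[[u v] /= Euv] N2 EN.
pose z := gaussI A B.
have Ez : z * gconj z = gaussI a 0 ^+ 5.
  rewrite gconjM /gnorm /= EN; apply: gauss_eq; rewrite !exprS !gmulE /=; ring.
have z0 : z <> 0 by case=> A0 B0; move: N2; rewrite A0 B0.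
have co : gcoprime z (gconj z).
  (* The coefficients below combine [2 = u (z + z') - i v (z - z')] with
     [1 = z z' - 2 h], where [z'] is the conjugate of [z]. *)
  have [h Eh] : exists h, A ^+ 2 + B ^+ 2 = 2 * h + 1.
    exists ((A ^+ 2 + B ^+ 2) %/ 2)%Z; move: (A ^+ 2 + B ^+ 2) N2; lia.
  have E2 : gaussI u 0 * (z + gconj z) + gaussI 0 (- v) * (z - gconj z) = gaussI 2 0.
    apply: gauss_eq; rewrite !(gmulE, gaddE, goppE) /=; move: Euv; lia.
  have E1 : z * gconj z - gaussI h 0 * gaussI 2 0 = 1.
    rewrite gconjM !(gmulE, gaddE, goppE) /gnorm /= Eh; apply: gauss_eq => /=; ring.
  exists (gconj z - gaussI h 0 * (gaussI u 0 + gaussI 0 (- v))).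
  exists (- (gaussI h 0 * (gaussI u 0 - gaussI 0 (- v)))).
  by rewrite -E1 -E2; ring.
have [w [d [Nw Ed]]] := gauss_coprime_factor_power co z0 Ez.
have {}Ed : z = (w * d) ^+ 5.
  by rewrite exprMn exprS (gauss_unit4 Nw) mulr1.
move: (w * d) Ed => [c e] Ed; exists c, e.
have : z = (c ^+ 5 - 10 * c ^+ 3 * e ^+ 2 + 5 * c * e ^+ 4,
            5 * c ^+ 4 * e - 10 * c ^+ 2 * e ^+ 3 + e ^+ 5).
  by rewrite Ed; apply: gauss_eq; rewrite !exprS expr0 !gmulE /=; ring.
by case.
Qed.

(** * Sums of two squares modulo a prime *)

(** An algebraic closure of ['F_p]; it provides [p]-th roots of unity and square
    roots of [-1] in characteristic [p]. *)
Lemma closed_field_of_char (p : nat) : prime p ->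
  exists K : closedFieldType, p \in [pchar K].
Proof.
move=> pp; have [K [f _]] := countable_algebraic_closure 'F_p.
by exists K; rewrite (fmorph_pchar f) pchar_Fp.
Qed.

Lemma frobeniusD (K : fieldType) (p : nat) (x y : K) : p \in [pchar K] ->
  (x + y) ^+ p = x ^+ p + y ^+ p.
Proof. by move=> cK; exact: (rmorphD (pFrobenius_aut cK)). Qed.

Lemma frobenius_int (K : fieldType) (p : nat) (n : int) : p \in [pchar K] ->
  (n%:~R : K) ^+ p = n%:~R.
Proof. by move=> cK; exact: (pFrobenius_aut_int cK). Qed.

Lemma closed_field_sqrtN1 (K : closedFieldType) : exists i : K, i ^+ 2 = -1.
Proof.
have /closed_rootP[i] : size ('X^2 + 1%:P : {poly K}) != 1 by rewrite size_XnaddC.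
by rewrite rootE !hornerE => /eqP E; exists i; apply/eqP; rewrite -addr_eq0 E.
Qed.

(** Here [i ^ p = i ^ 3 = - i], so the Frobenius map acts as complex
    conjugation. *)
Lemma frobenius_conj (K : fieldType) (p : nat) (i : K) (c d : int) :
    p \in [pchar K] -> (p %% 4 = 3)%N -> i ^+ 2 = -1 ->
  (c%:~R + i * d%:~R) ^+ p = c%:~R - i * d%:~R :> K.
Proof.
move=> cK p4 i2; rewrite frobeniusD // exprMn !frobenius_int //.
have i3 : i ^+ 3 = - i by rewrite exprS i2 mulrN1.
have i4 : i ^+ 4 = 1 by rewrite exprS i3 mulrN -expr2 i2 opprK.
by rewrite (divn_eq p 4) p4 exprD mulnC exprM i4 expr1n mul1r i3 mulNr.
Qed.

(** If [c + id] vanishes modulo [p], then so does its image [c - id] under the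
    Frobenius map, hence also their sum [2c]. *)
Lemma prime_dvd_sum_squares (p : nat) (c d : int) : prime p -> (p %% 4 = 3)%N ->
  (p %| c ^+ 2 + d ^+ 2)%Z -> (p %| c)%Z.
Proof.
move=> pp p4; have [K cK] := closed_field_of_char pp.
have [i i2] := closed_field_sqrtN1 K.
have Ec := frobenius_conj c d cK p4 i2.
have := frobenius_conj c (- d) cK p4 i2.
rewrite intrN mulrN opprK => Ed.
rewrite !(dvdz_pcharf cK) rmorphD !rmorphXn /=.
have -> : c%:~R ^+ 2 + d%:~R ^+ 2 = (c%:~R + i * d%:~R) * (c%:~R - i * d%:~R) :> K.
  by rewrite mulrC -subr_sqr exprMn i2 mulN1r opprK.
have n2 : 2%:~R != 0 :> K.
  rewrite -(dvdz_pcharf cK) dvdzE /= gtnNdvd //; move: p4 (prime_gt1 pp).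
  by case: (p) => [|[|[|]]].
have p0 := prime_gt0 pp.
have sum0 : c%:~R + i * d%:~R = 0 -> c%:~R - i * d%:~R = 0 -> c%:~R == 0 :> K.
  move=> E1 E2; have : 2%:~R * c%:~R = 0 :> K.
    by rewrite -[RHS]addr0 -{1}E1 -E2; ring.
  by move/eqP; rewrite mulf_eq0 (negPf n2).
rewrite mulf_eq0 => /orP[] /eqP E; apply: sum0 => //.
  by rewrite -Ec E expr0n -[p]prednK.
by rewrite -Ed E expr0n -[p]prednK.
Qed.

(** Let [a = c + id] and [b = c - id] in a field of characteristic [p], so
    that [a ^ p = b] and [b ^ p = a].  If [A B] vanishes, then
    [a ^ 10 = b ^ 10], as the difference of both sides is [4 i A B].  Also
    [a ^ p.+1 = a b = b ^ p.+1].  As [p + 1 = 4 mod 20], these combine into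
    [a ^ 2 = b ^ 2], which says [4 i c d = 0]. *)
Lemma prime_dvd_fifth_power_parts (p : nat) (c d A B : int) : prime p -> (p %% 20 = 3)%N ->
  A = c ^+ 5 - 10 * c ^+ 3 * d ^+ 2 + 5 * c * d ^+ 4 ->
  B = 5 * c ^+ 4 * d - 10 * c ^+ 2 * d ^+ 3 + d ^+ 5 ->
  (p %| A * B)%Z -> (p %| c * d)%Z.
Proof.
move=> pp p20 EA EB; have p4 : (p %% 4 = 3)%N by move: p20; clear; lia.
have [K cK] := closed_field_of_char pp.
have [i i2] := closed_field_sqrtN1 K.
have := frobenius_conj c (- d) cK p4 i2.
rewrite intrN mulrN opprK; have := frobenius_conj c d cK p4 i2.
rewrite !(dvdz_pcharf cK) !intrM.
have -> : A%:~R = c%:~R ^+ 5 - 10 * c%:~R ^+ 3 * d%:~R ^+ 2 + 5 * c%:~R * d%:~R ^+ 4 :> K.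
  by rewrite EA; ring.
have -> : B%:~R = 5 * c%:~R ^+ 4 * d%:~R - 10 * c%:~R ^+ 2 * d%:~R ^+ 3 + d%:~R ^+ 5 :> K.
  by rewrite EB; ring.
move: (c%:~R : K) (d%:~R : K) => u v.
set a := u + i * v; set b := u - i * v => ab ba AB0.
have n4 : 4%:R != 0 :> K.
  rewrite -(dvdn_pcharf cK); apply/negP=> p_dvd4.
  have := dvdn_leq (isT : (0 < 4)%N) p_dvd4.
  by move: p20 p_dvd4; clear; case: (p) => [|[|[|[|[|]]]]].
have i0 : i != 0.
  by apply/eqP=> i0; move/esym/eqP: i2; rewrite i0 expr0n oppr_eq0 oner_eq0.
have fifth w : (u + i * w) ^+ 5 =
    u ^+ 5 - 10 * u ^+ 3 * w ^+ 2 + 5 * u * w ^+ 4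
    + i * (5 * u ^+ 4 * w - 10 * u ^+ 2 * w ^+ 3 + w ^+ 5).
  have -> : (u + i * w) ^+ 5 = u ^+ 5 + 5 * u ^+ 4 * (i * w)
     + 10 * u ^+ 3 * w ^+ 2 * i ^+ 2 + 10 * u ^+ 2 * w ^+ 3 * (i ^+ 2 * i)
     + 5 * u * w ^+ 4 * (i ^+ 2) ^+ 2 + w ^+ 5 * ((i ^+ 2) ^+ 2 * i) by ring.
  by rewrite i2; ring.
have ab10 : a ^+ 10 = b ^+ 10.
  have Eb : b = u + i * - v by rewrite /b mulrN.
  apply/eqP; rewrite -subr_eq0 (exprM a 5 2) (exprM b 5 2) Eb !fifth.
  move/eqP: AB0 => AB0; apply/eqP.
  by rewrite -[RHS](mulr0 (4 * i)) -AB0; ring.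
have ab1 : a ^+ (p.+1) = b ^+ (p.+1) by rewrite !exprSr ab ba mulrC.
have ab2 : a ^+ 2 = b ^+ 2.
  have [a0|a0] := eqVneq a 0.
    have b0 : b = 0 by rewrite -ab a0 expr0n; case: (p) pp.
    by rewrite a0 b0.
  have Ep : p.+1 = (10 * (2 * (p %/ 20)) + 4)%N.
    by move: p20 (divn_eq p 20); clear; lia.
  have ab4 : a ^+ 4 = b ^+ 4.
    move: ab1; rewrite Ep !(exprD _ (10 * _)%N 4) !(exprM _ 10 (2 * _)%N) ab10; apply: mulfI.
    by rewrite -ab10 !expf_neq0.
  move: ab10; rewrite !(exprD _ 8 2) !(exprM _ 4 2) ab4; apply: mulfI.
  by rewrite -ab4 !expf_neq0.
have : 4%:R * i * (u * v) = 0.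
  by apply/eqP; rewrite -(subrr (a ^+ 2)) {2}ab2 /a /b; apply/eqP; ring.
by move/eqP; rewrite mulf_eq0 mulf_eq0 (negPf n4) (negPf i0).
Qed.

(** * A case of quadratic reciprocity *)

(** The value at 1 of the quotient of [X^n - 1] by [X - 1]. *)
Lemma prod_one_sub_prim_root (K : fieldType) (n : nat) (z : K) :
  n.-primitive_root z -> \prod_(1 <= k < n) (1 - z ^+ k) = n%:R.
Proof.
move=> zn; have n0 := prim_order_gt0 zn.
have := factor_Xn_sub_1 zn; rewrite big_ltn // expr0 subrX1 => /mulfI E.
have {}E := congr1 (fun P => P.[1]) (E (negbT (polyXsubC_eq0 _))).
move: E; rewrite horner_prod horner_sum.
under eq_bigr do rewrite !hornerE.
under [in RHS]eq_bigr do rewrite !hornerE expr1n.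
by rewrite sumr_const card_ord.
Qed.

Lemma prime_prim_root (K : closedFieldType) (p : nat) : prime p ->
  p%:R != 0 :> K -> exists z : K, p.-primitive_root z.
Proof.
move=> pp p0; have p_gt1 := prime_gt1 pp; have p_gt0 := prime_gt0 pp.
pose P : {poly K} := \poly_(i < p) 1.
have /closed_rootP[z] : size P != 1.
  by rewrite size_poly_eq ?oner_eq0 // -(subnKC p_gt1).
rewrite rootE /P poly_def horner_sum.
under eq_bigr do rewrite scale1r hornerXn.
move=> /eqP z0; have zp : z ^+ p = 1.
  by apply/eqP; rewrite -subr_eq0 subrX1 z0 mulr0.
have [m zm mp] := prim_order_exists p_gt0 zp.
exists z; have [_ /(_ _ mp)/orP[/eqP m1|/eqP <- //]] := primeP pp.
move: zm z0; rewrite m1 => /prim_expr_order; rewrite expr1 => ->.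
by under eq_bigr do rewrite expr1n; rewrite sumr_const card_ord => /eqP; rewrite (negPf p0).
Qed.

Lemma prod_nat_pairs (R : comNzRingType) (h : nat) (F : nat -> R) :
  \prod_(1 <= k < (h.*2).+1) F k = \prod_(1 <= k < h.+1) (F k * F ((h.*2).+1 - k)%N).
Proof.
rewrite (@big_cat_nat _ _ _ h.+1) //=; last by rewrite ltnS -addnn leq_addr.
rewrite big_split /=; congr (_ * _).
rewrite -[X in \big[_/_]_(X <= _ < _) _]add0n big_addn big_add1 subSS -addnn addnK /=.
rewrite big_nat_rev /= !big_nat; apply: eq_bigr => k /andP[_ kh].
by congr F; lia.
Qed.

(** The product under the exponent is [- t ^ 2] for [t = w - 1 / w].  The
    Frobenius map sends [w] to its inverse, hence [t] to [- t], so
    [t ^ q.-1 = - 1]; and [- 1] to the odd power [q.-1 / 2] is [- 1] as well. *)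
Lemma half_power_norm_factor (K : fieldType) (q : nat) (w : K) : q \in [pchar K] ->
  (q %% 4 = 3)%N -> w ^+ q.+1 = 1 -> w ^+ 2 != 1 ->
  ((1 - w ^+ 2) * (1 - w ^- 2)) ^+ (q.-1)./2 = 1.
Proof.
move=> cK q4 wq w2.
have w0 : w != 0 by apply: contra_eq_neq wq => ->; rewrite expr0n eq_sym oner_eq0.
have wV : w ^+ q = w^-1.
  by apply: (mulfI w0); rewrite -exprS wq divff.
pose t := w - w^-1.
have t0 : t != 0.
  apply: contra w2; rewrite subr_eq0 => /eqP E.
  by rewrite expr2 {2}E divff.
have tq : t ^+ q = - t.
  have qo : odd q by move: q4; clear; lia.
  by rewrite /t frobeniusD // exprNn -signr_odd qo expr1 mulN1r exprVn wV invrK opprB addrC.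
have tq1 : t ^+ q.-1 = -1.
  apply: (mulfI t0); rewrite -exprS prednK ?tq ?mulrN1 //.
  by case: (q) q4.
have -> : (1 - w ^+ 2) * (1 - w ^- 2) = - 1 * t ^+ 2.
  by rewrite /t; field.
have Eq : q.-1 = (2 * (q.-1)./2)%N by move: q4; clear; lia.
rewrite exprMn -exprM -Eq tq1 -signr_odd.
by have -> : odd (q.-1)./2; [move: q4; clear; lia | rewrite expr1 mulrNN mulr1].
Qed.

(** In characteristic [q], take a primitive
    [p]-th root of unity [z].  Then [p] is the product of the
    [(1 - z ^ k) (1 - z ^ - k)] for [0 < k <= (p - 1) / 2], and
    [half_power_norm_factor] applies to each of these, as [p] divides
    [q + 1]. *)
Lemma half_power_eq1_dvd_succ (p q : nat) : prime p -> odd p -> prime q -> (q %% 4 = 3)%N ->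
  (p %| q.+1)%N -> p ^ (q.-1)./2 = 1 %[mod q].
Proof.
move=> pp po pq q4 pq1.
have [K cK] := closed_field_of_char pq.
have p0 : p%:R != 0 :> K.
  rewrite -(dvdn_pcharf cK) dvdn_prime2 //; apply/eqP=> E.
  by move: pq1; rewrite -E -addn1 dvdn_addr // dvdn1 => /eqP q1; rewrite q1 in pq.
have [z zp] := prime_prim_root pp p0; have zp1 := prim_expr_order zp.
have [h Ep] : exists h, p = (h.*2).+1 by exists p./2; rewrite -[LHS]odd_double_half po.
have factor k : (0 < k < p)%N -> ((1 - z ^+ k) * (1 - z ^+ (p - k))) ^+ (q.-1)./2 = 1.
  (* As [h.+1] is half of [p + 1], this is a square root of [z ^+ k]. *)
  move=> /andP[k0 kp]; pose w := z ^+ (h.+1 * k).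
  have w2 : w ^+ 2 = z ^+ k.
    rewrite -exprM mulnAC (_ : (h.+1 * 2 = p + 1)%N) ?mulnDl ?mul1n; last by lia.
    by rewrite exprD exprM zp1 expr1n mul1r.
  have zk0 : z ^+ k != 0 by rewrite expf_neq0 // (prim_root_eq0 zp) -lt0n prime_gt0.
  have -> : z ^+ (p - k) = w ^- 2.
    rewrite w2; apply: (mulfI zk0).
    by rewrite -exprD subnKC ?zp1 ?divff // ltnW.
  rewrite -w2; apply: half_power_norm_factor => //.
    by case/dvdnP: pq1 => m ->; rewrite (mulnC m) exprM /w (exprAC z) zp1 !expr1n.
  by rewrite w2 -(prim_order_dvd zp) gtnNdvd.
have Eprod : p%:R = \prod_(1 <= k < h.+1) ((1 - z ^+ k) * (1 - z ^+ (p - k))).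
  by rewrite -(prod_one_sub_prim_root zp) Ep prod_nat_pairs.
have : (p%:R : K) ^+ (q.-1)./2 = 1.
  rewrite Eprod -prodrXl big_nat big1 // => k kh; apply: factor.
  by rewrite Ep; move: kh; clear; lia.
move/eqP; rewrite -natrX -subr_eq0.
have pe : (0 < p ^ (q.-1)./2)%N by rewrite expn_gt0 prime_gt0.
rewrite -(natrB _ pe) -(dvdn_pcharf cK) => d.
by apply/eqP; rewrite eqn_mod_dvd.
Qed.

(** Some power of the generator is [- 1], whose power [q.-1 / 2] is [- 1]
    since this exponent is odd; hence the same power of the generator is not
    1. *)
Lemma generator_half_power_neq1 (p q : nat) : prime q -> (q %% 4 = 3)%N ->
  class_generates_units (q ^ 4)%N p -> p ^ (q.-1)./2 <> 1 %[mod q].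
Proof.
move=> pq q4 [u Eu gu] p1.
have q1 : (1 < q ^ 4)%N by rewrite -(exp1n 4) ltn_exp2r // prime_gt1.
have [k Ek] : exists k, (p%:R : 'Z_(q ^ 4)) ^+ k = -1.
  pose v : {unit 'Z_(q ^ 4)} := FinRing.Unit (unitrN1 _).
  have : v \in <[u]>%g by rewrite -(eqP gu) inE.
  by case/cycleP=> k Ek; exists k; rewrite -Eu -FinRing.val_unitX -Ek.
have dvd4 : (q ^ 4 %| p ^ k + 1)%N.
  have : (p ^ k + 1)%:R = 0 :> 'Z_(q ^ 4) by rewrite natrD natrX Ek addNr.
  by move/(congr1 val); rewrite /= val_Zp_nat // => /eqP.
have cF := pchar_Fp pq.
have Ek1 : (p%:R : 'F_q) ^+ k = -1.
  apply/eqP; rewrite -addr_eq0 -natrX -(natrD _ _ 1) -(dvdn_pcharf cF).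
  by apply: dvdn_trans dvd4; rewrite dvdn_exp.
have Em1 : (p%:R : 'F_q) ^+ (q.-1)./2 = 1.
  by rewrite -natrX -[LHS](Fp_nat_mod pq) p1 Fp_nat_mod.
have mo : odd (q.-1)./2 by move: q4; clear; lia.
have : (2%:R : 'F_q) = 0.
  have : (p%:R : 'F_q) ^+ k ^+ (q.-1)./2 = 1 by rewrite exprAC Em1 expr1n.
  by rewrite Ek1 -signr_odd mo expr1 mulr2n => E; rewrite -{1}E addNr.
move/eqP; rewrite -(dvdn_pcharf cF) => /(dvdn_leq (isT : (0 < 2)%N)).
by move: q4; case: (q) => [|[|[|]]].
Qed.

(** * The equation *)

(** [m] is prime to [U], so it divides [V] and can be cancelled. *)
Lemma coprimez_mul_expz (n : nat) (m U V w : int) : (0 < n)%N -> m != 0 -> 0 <= U ->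
  coprimez U V -> coprimez U m -> U * V = m * w ^+ n -> exists a : int, U = a ^+ n.
Proof.
move=> n0 m0 U0 coV com E.
have /dvdzP[V' EV] : (m %| V)%Z.
  by rewrite -(@Gauss_dvdzr _ U) 1?coprimez_sym // E dvdz_mulr.
have E' : U * V' = w ^+ n by apply: (mulfI m0); rewrite -E EV; ring.
have co : coprime `|U| `|V'|.
  by move: coV; rewrite EV coprimezMr => /andP[].
have [|a Ea _] := @coprime_mul_expn n `|U| `|V'| `|w| n0 co.
  by rewrite -abszM E' abszX.
by exists a%:Z; rewrite -(gez0_abs U0) Ea -!natz natrX.
Qed.

Lemma coprimez_sum_squares_prime (p : nat) (c d : int) : prime p -> (p %% 4 = 3)%N ->
  coprimez c d -> coprimez (c ^+ 2 + d ^+ 2) p.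
Proof.
move=> pp p4 co; rewrite coprimez_sym coprimezE /= prime_coprime //.
apply/negP=> pN; have pc := @prime_dvd_sum_squares p c d pp p4 pN.
have pd : (p %| d)%Z by apply: (@prime_dvd_sum_squares p d c pp p4); rewrite addrC.
have : (p%:Z %| gcdz c d)%Z by rewrite dvdz_gcd pc.
by rewrite (eqP co) dvdz1 /= => /eqP p1; rewrite p1 in pp.
Qed.

Lemma coprimez_sum_squares_l (c d : int) : coprimez c d ->
  coprimez (c ^+ 2 + d ^+ 2) c.
Proof.
move=> co; rewrite coprimez_sym /coprimez expr2 gcdzMDl.
by rewrite -/(coprimez _ _) coprimezXr.
Qed.

Lemma coprimez_odd (n : int) : ~~ (2 %| n)%Z -> coprimez n 2.
Proof. by rewrite coprimez_sym coprimezE dvdzE /= prime_coprime. Qed.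

Lemma dvdz_prime (q : nat) (d : int) : prime q -> (d %| q%:Z)%Z ->
  [\/ d = 1, d = -1, d = q%:Z | d = - q%:Z].
Proof.
move=> /primeP[_ H]; rewrite dvdzE /= => /H /orP[] /eqP; case: d => n /=; rewrite ?NegzE.
- by move->; constructor 1.
- by case=> ->; constructor 2.
- by move->; constructor 3.
- by move->; constructor 4.
Qed.

(** [d] divides the prime [q], and each of the four possible values of [d] is
    excluded modulo 5, by size, or by [quartic_form_eq1]. *)
Lemma prime_neq_imaginary_part_fifth_power (q : nat) (c d : int) : prime q -> (q %% 5 = 4)%N ->
  q%:Z = 5 * c ^+ 4 * d - 10 * c ^+ 2 * d ^+ 3 + d ^+ 5 -> False.
Proof.
move=> pq q5 E; have q_gt1 := prime_gt1 pq.
have q0 : q%:Z != 0 by rewrite -lt0n ltnW.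
have q4m : (q ^ 4 = 1 %[mod 5])%N by rewrite -modnXm q5.
have /(dvdz_prime pq)[] : (d %| q%:Z)%Z.
- by apply/dvdzP; exists (5 * c ^+ 4 - 10 * c ^+ 2 * d ^+ 2 + d ^+ 4); rewrite E; ring.
- move=> d1; move: E; rewrite d1 !expr1n.
  by move: (c ^+ 4) (c ^+ 2) q5; clear; lia.
- move=> d1; have q4 : q%:Z = 4 - 5 * (c ^+ 2 - 1) ^+ 2 by rewrite E d1; ring.
  have : q = 4%N by move: (sqr_ge0 (c ^+ 2 - 1)) q4 q5; move: (_ ^+ 2) => s; clear; lia.
  by move=> q4'; rewrite q4' in pq.
- move=> dq; have E1 : 1 = 5 * c ^+ 4 - 10 * c ^+ 2 * q%:Z ^+ 2 + q%:Z ^+ 4.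
    by apply: (mulfI q0); rewrite mulr1 {1}E dq; ring.
  have [n En] : exists n : nat, c ^+ 2 = n%:Z ^+ 2.
    by exists `|c|%N; rewrite abszE real_normK ?num_real.
  have E2 : (q ^ 4 + 5 * n ^ 4 = 10 * n ^ 2 * q ^ 2 + 1)%N.
    have n4 : c ^+ 4 = n%:Z ^+ 4 by rewrite !(exprM _ 2 2) En.
    by apply/eqP; rewrite -eqz_nat; apply/eqP; move: E1; rewrite En n4; clear; lia.
  have := quartic_form_eq1 E2; rewrite -modnXm q5 => /(_ erefl) => /eqP.
  by rewrite -{2}(exp1n 2) eqn_exp2r // => /eqP q1'; rewrite q1' in q_gt1.
- move=> dq; have E1 : - 1 = 5 * c ^+ 4 - 10 * c ^+ 2 * q%:Z ^+ 2 + q%:Z ^+ 4.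
    by apply: (mulfI q0); rewrite mulrN1 {1}E dq; ring.
  have : q%:Z ^+ 4 = 5 * (2 * c ^+ 2 * q%:Z ^+ 2 - c ^+ 4) - 1.
    by rewrite E1; ring.
  by move: (_ - c ^+ 4) q4m; clear; lia.
Qed.

(** With [e = c + d] and [f = c d], the sum of the real and imaginary parts of
    [(c + i d)^5] is [e (e^4 - 20 f^2)].  So [e] divides the prime [q], and
    [e = - 1] is the only value compatible with [q = 4 mod 5] and
    [pow4_eq_20square_add1]. *)
Lemma prime_eq_sum_parts_fifth_power (q : nat) (c d A B : int) : prime q -> (q %% 5 = 4)%N -> odd q ->
  A = c ^+ 5 - 10 * c ^+ 3 * d ^+ 2 + 5 * c * d ^+ 4 ->
  B = 5 * c ^+ 4 * d - 10 * c ^+ 2 * d ^+ 3 + d ^+ 5 ->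
  q%:Z = A + B -> q.+1 = (20 * absz (c * d)%R ^ 2)%N.
Proof.
move=> pq q5 qo EA EB E.
have {EA EB}E : q%:Z = (c + d) * ((c + d) ^+ 4 - 20 * (c * d) ^+ 2) by rewrite E EA EB; ring.
have q4m : (q ^ 4 = 1 %[mod 5])%N by rewrite -modnXm q5.
have /(dvdz_prime pq) : (c + d %| q%:Z)%Z by rewrite E dvdz_mulr.
have q0 : q%:Z != 0 by rewrite -lt0n prime_gt0.
move: E; move: (c + d) (c * d) => e f E.
case=> Ee; rewrite Ee in E.
- by move: E q5; rewrite expr1n; move: (f ^+ 2); clear; lia.
- by move: E; rewrite -abszX; move: (f ^+ 2) (sqr_ge0 f); clear; lia.
- have E1 : 1 = q%:Z ^+ 4 - 20 * f ^+ 2.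
    by apply: (mulfI q0); rewrite mulr1 {1}E; ring.
  have [] := @pow4_eq_20square_add1 q `|f| _ _; last by rewrite q5.
  by apply/eqP; rewrite -eqz_nat; apply/eqP; move: E1; rewrite -abszX; move: (sqr_ge0 f); move: (f ^+ 2); clear; lia.
- have E1 : - 1 = q%:Z ^+ 4 - 20 * f ^+ 2.
    by apply: (mulfI q0); rewrite mulrN1 {1}E; ring.
  by move: E1; move: (f ^+ 2) q4m; clear; lia.
Qed.

Theorem theorem2p3 (p q : nat)
    (hp : prime p) (hq : prime q) (hpq : p <> q)
    (hp20 : p = 3 %[mod 20]) (hq5 : q = 4 %[mod 5])
    (hgen : class_generates_units (q ^ 4)%N p)
    (h2 : power_residue 5 2 q%:Z) :
  ~ exists x y : int,
      [/\ x ^+ 4 - q%:Z ^+ 4 = p%:Z * y ^+ 5,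
          ~ trivial_solution (x, y),
          ~~ (p%:Z %| y)%Z
        & coprimez x y].
Proof.
move=> [x [y [E _ _ coxy]]].
have p4 : (p %% 4 = 3)%N by move: hp20; clear; lia.
have p20 : (p %% 20 = 3)%N by rewrite hp20.
have q5 : (q %% 5 = 4)%N by rewrite hq5.
have qo : odd q.
  by case: (even_prime hq) => // q2; rewrite q2 in q5.
have p0 : p%:Z != 0 by rewrite -lt0n prime_gt0.
have coxq : coprimez x q.
  rewrite coprimez_sym coprimezE /= prime_coprime //; apply/negP=> qx.
  have : (q %| p%:Z * y ^+ 5)%Z.
    by rewrite -E rpredB // exprS dvdz_mulr.
  rewrite dvdzE abszM Euclid_dvdM // abszX Euclid_dvdX // andbT => /orP[|qy].
    by rewrite /= dvdn_prime2 // => /eqP qp; apply: hpq.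
  have : (q%:Z %| gcdz x y)%Z by rewrite dvdz_gcd dvdzE qx.
  by rewrite (eqP coxy) dvdz1 /= => /eqP q1; rewrite q1 in hq.
have [xo|xo] := boolP (2 %| x)%Z.
  have N2 : ~~ (2 %| x ^+ 2 + q%:Z ^+ 2)%Z.
    by move: xo qo; rewrite !expr2; clear; nia.
  have coN : coprimez (x ^+ 2 + q%:Z ^+ 2) (x ^+ 2 - q%:Z ^+ 2).
    have -> : x ^+ 2 - q%:Z ^+ 2 = 1 * (x ^+ 2 + q%:Z ^+ 2) + - 2 * q%:Z ^+ 2 by ring.
    rewrite /coprimez gcdzMDl -/(coprimez _ _) coprimezMr coprimezN coprimez_odd //=.
    by rewrite addrC coprimezXr // coprimez_sum_squares_l // coprimez_sym.
  have [||a Ea] := @coprimez_mul_expz 5 p _ _ y isT p0 _ coN (coprimez_sum_squares_prime hp p4 coxq).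
  - by rewrite addr_ge0 ?sqr_ge0.
  - by rewrite -E; ring.
  have [c [d [_ Eq]]] := gauss_fifth_power coxq N2 Ea.
  exact: prime_neq_imaginary_part_fifth_power hq q5 Eq.
(* [A + iB] is the quotient of [x + iQ] by [1 + i]. *)
have [A [B [Ex Eq]]] : exists A B : int, x = A - B /\ q%:Z = A + B.
  by exists ((q%:Z + x) %/ 2)%Z, ((q%:Z - x) %/ 2)%Z; move: xo qo; clear; lia.
have coAB : coprimez A B.
  have /coprimezP[[u v] /= Euv] := coxq; apply/coprimezP; exists (u + v, v - u) => /=.
  by rewrite -Euv Ex Eq; ring.
have N2 : ~~ (2 %| A ^+ 2 + B ^+ 2)%Z.
  have -> : A ^+ 2 + B ^+ 2 = q%:Z ^+ 2 - 2 * (A * B) by rewrite Eq; ring.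
  by move: qo; rewrite expr2; move: (A * B); clear; nia.
have coN2 := coprimez_odd N2.
have coN : coprimez (A ^+ 2 + B ^+ 2) (- 8 * (A * B)).
  rewrite coprimezMr coprimezN (coprimezXr 3 coN2) coprimezMr coprimez_sum_squares_l //=.
  by rewrite addrC coprimez_sum_squares_l // coprimez_sym.
have coNp := coprimez_sum_squares_prime hp p4 coAB.
(* The factor 8 need not be extracted from [y ^ 5]: it only has to be prime to
   the odd number [A ^ 2 + B ^ 2]. *)
have EAB : (A ^+ 2 + B ^+ 2) * (- 8 * (A * B)) = p%:Z * y ^+ 5.
  by rewrite -E Ex Eq; ring.
have [|a Ea] := coprimez_mul_expz (isT : (0 < 5)%N) p0 _ coN coNp EAB.
  by rewrite addr_ge0 ?sqr_ge0.
have [c [d [EA EB]]] := gauss_fifth_power coAB N2 Ea.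
have q1 := prime_eq_sum_parts_fifth_power hq q5 qo EA EB Eq.
have pcd : (p %| c * d)%Z.
  apply: (prime_dvd_fifth_power_parts hp p20 EA EB).
  have : (p %| (A ^+ 2 + B ^+ 2) * (- 8 * (A * B)))%Z by rewrite EAB dvdz_mulr.
  rewrite Gauss_dvdzr; last by rewrite coprimez_sym.
  move=> pAB; rewrite -(@Gauss_dvdzr _ (- 8)) // coprimezE /= prime_coprime //.
  apply/negP=> p8; have : (p %| 2 ^ 3)%N by [].
  by rewrite Euclid_dvdX // dvdn_prime2 // => /andP[/eqP p2 _]; rewrite p2 in p4.
have q4 : (q %% 4 = 3)%N by move: q1; clear; lia.
apply: (generator_half_power_neq1 hq q4 hgen).
apply: half_power_eq1_dvd_succ => //; first by move: p4; clear; lia.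
by rewrite q1 dvdn_mull // dvdn_exp.
Qed.
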